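(* For every integer $n\ge1$, $\psi'_{n,\mathrm{cl}}$ is a density of integral of motion of the classical sine-Gordon system on the lattice, that is, $\{\Sigma^+,\psi'_{n,\mathrm{cl}}\}$ and $\{\Sigma^-,\psi'_{n,\mathrm{cl}}\}$ belong to $\mathrm{Im}(T-\mathrm{Id})$. More precisely, $$\{\Sigma^+,\psi'_{n,\mathrm{cl}}\}=0,\qquad \{\Sigma^-,\psi'_{n,\mathrm{cl}}\}=(T-\mathrm{Id})\bigl(\{A'_{n,\mathrm{cl}},\Sigma^-\}\bigr).$$
   Context: Let $R=\mathbb{C}[x_i^{\pm1},y_i^{\pm1},\,i\in\mathbb{Z}]$ be the commutative Laurent polynomial ring with the Poisson bracket determined by: $\{x_i,y_i\}=-x_iy_i$ for all $i$, and for $i<j$, $\{x_i,x_j\}=x_ix_j$, $\{x_i,y_j\}=-x_iy_j$, $\{y_i,y_j\}=y_iy_j$, $\{y_i,x_j\}=-y_ix_j$ (extended by antisymmetry and the Leibniz rule). Grade $R$ by $\deg x_i=1=-\deg y_i$. For $P\in R$ of degree $0$, put $\{\Sigma^+,P\}=\sum_{i\in\mathbb{Z}}\{x_i,P\}$, $\{\Sigma^-,P\}=\sum_{i\in\mathbb{Z}}\{y_i,P\}$ (finitely many nonzero terms for each $P$), and $\{P,\Sigma^-\}=-\{\Sigma^-,P\}$. $T$ is the ring automorphism $x_i\mapsto x_{i+1}$, $y_i\mapsto y_{i+1}$ of $R$, and $T^{1/2}$ the ring automorphism $x_i\mapsto y_i$, $y_i\mapsto x_{i+1}$. For $(m,p)\in\mathbb{Z}^2$,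 $\binom mp$ equals $1$ if $p=0$; $0$ if $p<0$ or $p>\max(0,m)$; and the usual binomial coefficient if $0\le p\le m$. For $n\ge1$ choose any integer $N$ with $n\le2(N-1)$, let $I_n$ be the set of $(\alpha_1,\dots,\alpha_{2N-2})\in\mathbb{N}^{2N-2}$ ($\mathbb{N}=\{0,1,\dots\}$) with $\alpha_1\ge1$ and $\sum\alpha_i=n$, and put $$A'_{n,\mathrm{cl}}=\sum_{\underline\alpha\in I_n}\frac1{\alpha_1}\prod_{i=1}^{2N-3}\binom{\alpha_i+\alpha_{i+1}-1}{\alpha_{i+1}}\,(x_1y_1)^{-\alpha_1}(y_1x_2)^{-\alpha_2}\cdots(x_{N-1}y_{N-1})^{-\alpha_{2N-3}}(y_{N-1}x_N)^{-\alpha_{2N-2}},$$ $B'_{n,\mathrm{cl}}=T^{1/2}(A'_{n,\mathrm{cl}})$, $\psi'_{n,\mathrm{cl}}=A'_{n,\mathrm{cl}}+B'_{n,\mathrm{cl}}$; these do not depend on the choice of $N$. *)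

(* Defs.v *)
From HB Require Import structures.
From mathcomp Require Import all_boot all_order all_algebra finmap.
From mathcomp Require Import boolp classical_sets functions cardinality fsbigop.
From mathcomp Require Import reals complex.
From mathcomp.multinomials Require Import monalg.
From mathcomp Require Import ring.

Set Implicit Arguments.
Unset Strict Implicit.
Unset Printing Implicit Defensive.

Import Order.TTheory GRing.Theory Num.Theory.
Local Open Scope ring_scope.

Section MalgExtra.
Variables (K : choiceType) (G : zmodType).

Lemma malg_ind (Q : {malg G[K]} -> Prop) :
  Q 0 -> (forall c k, Q << c *g k >>) -> (forall p q, Q p -> Q q -> Q (p + q)) ->
  forall p, Q p.
Proof. by move=> Q0 QU QD p; rewrite (monalgE p); apply: big_ind. Qed.

Lemma malgU_mulz (c : G) (k : K) (n : int) :
  << c *~ n *g k >> = << c *g k >> *~ n :> {malg G[K]}.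
Proof. by rewrite raddfMz. Qed.

End MalgExtra.

(* Push-forward of finitely supported functions along [h]. *)
HB.lock Definition malg_push (K K' : choiceType) (G : zmodType) (h : K -> K')
    (p : {malg G[K]}) : {malg G[K']} := \sum_(k <- msupp p) << p@_k *g h k >>.

Section Push.
Variables (K K' : choiceType) (G : zmodType) (h : K -> K').

Local Notation push := (malg_push (G := G) h).

Lemma malg_pushEw (d : {fset K}) (p : {malg G[K]}) :
  (msupp p `<=` d)%fset -> push p = \sum_(k <- d) << p@_k *g h k >>.
Proof.
move=> le; rewrite malg_push.unlock (big_fset_incl _ le) //= => k _ /mcoeff_outdom ->.
by rewrite monalgU0.
Qed.

Lemma malg_push_is_additive : zmod_morphism (push).
Proof.
move=> p q; have lp := fsubsetUl (msupp p) (msupp q).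
have lq := fsubsetUr (msupp p) (msupp q).
rewrite (malg_pushEw (msuppB_le p q)) (malg_pushEw lp) (malg_pushEw lq).
by rewrite -sumrB; apply: eq_bigr => k _; rewrite mcoeffB monalgUB.
Qed.

HB.instance Definition _ := GRing.isZmodMorphism.Build {malg G[K]} {malg G[K']}
  (push) malg_push_is_additive.

Lemma malg_pushU c k : push << c *g k >> = << c *g h k >>.
Proof. by rewrite (malg_pushEw msuppU_le) big_seq_fset1 mcoeffUU. Qed.

End Push.

(* [{malg F[E]}] is a ring in the library only when the monoid [E] has no
   nontrivial unit, which excludes negative exponents; [gralg] is the group
   algebra of the additive group [E]. The element [<< c *g a >>] is c z^a. *)
Definition gralg (E : zmodType) (F : fieldType) : Type := {malg F[E]}.

HB.instance Definition _ (E : zmodType) (F : fieldType) :=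
  GRing.Zmodule.on (gralg E F).

(* Locked to keep unification problems small. *)
HB.lock Definition gr_scale (E : zmodType) (F : fieldType) (c : F)
    (p : gralg E F) : gralg E F := c *: (p : {malg F[E]}).

Section Scale.
Variables (E : zmodType) (F : fieldType).
Local Notation scale := (@gr_scale E F).

Lemma gr_scaleA (c d : F) p : scale c (scale d p) = scale (c * d) p.
Proof. by rewrite gr_scale.unlock scalerA. Qed.
Lemma gr_scale1 : left_id 1 scale.
Proof. by move=> p; rewrite gr_scale.unlock scale1r. Qed.
Lemma gr_scaleDr : right_distributive scale +%R.
Proof. by move=> c p q; rewrite gr_scale.unlock scalerDr. Qed.
Lemma gr_scaleDl p : {morph scale^~ p : c d / c + d}.
Proof. by move=> c d; rewrite gr_scale.unlock scalerDl. Qed.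
End Scale.

HB.instance Definition _ (E : zmodType) (F : fieldType) :=
  GRing.Zmodule_isLmodule.Build F (gralg E F) (@gr_scaleA E F)
    (@gr_scale1 E F) (@gr_scaleDr E F) (@gr_scaleDl E F).

Lemma mcoeff_grZ (E : zmodType) (F : fieldType) (c : F) (p : gralg E F) a :
  (c *: p)@_a = c * p@_a.
Proof. by rewrite /GRing.scale /= gr_scale.unlock mcoeffZ. Qed.

(* The bilinear map with (z^a, z^b) |-> w(a, b) z^(a + b). *)
HB.lock Definition conv (E : zmodType) (F : fieldType) (w : E -> E -> F)
    (p q : gralg E F) : gralg E F :=
  \sum_(a <- msupp p) \sum_(b <- msupp q) << w a b * (p@_a * q@_b) *g a + b >>.

Section Convolution.
Variables (E : zmodType) (F : fieldType).
Implicit Types (p q r : gralg E F) (w : E -> E -> F).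

Lemma convEw (d1 d2 : {fset E}) w p q :
  (msupp p `<=` d1)%fset -> (msupp q `<=` d2)%fset ->
  conv w p q =
  \sum_(a <- d1) \sum_(b <- d2) << w a b * (p@_a * q@_b) *g a + b >>.
Proof.
move=> le1 le2; rewrite conv.unlock (big_fset_incl _ le1) /=.
  apply/eq_bigr => a _; apply/big_fset_incl => // b _ /mcoeff_outdom ->.
  by rewrite !mulr0 monalgU0.
move=> a _ /mcoeff_outdom pa; rewrite big1 // => b _.
by rewrite pa mul0r mulr0 monalgU0.
Qed.

Lemma convUU w c d a b :
  conv w << c *g a >> << d *g b >> = << w a b * (c * d) *g a + b >>.
Proof. by rewrite (convEw _ msuppU_le msuppU_le) !big_seq_fset1 !mcoeffUU. Qed.

Lemma convDl w : left_distributive (conv w) +%R.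
Proof.
move=> p q r; pose d := (msupp p `|` msupp q)%fset.
rewrite (convEw w (msuppD_le p q) (fsubset_refl (msupp r))).
rewrite (convEw w (fsubsetUl (msupp p) (msupp q)) (fsubset_refl (msupp r))).
rewrite (convEw w (fsubsetUr (msupp p) (msupp q)) (fsubset_refl (msupp r))).
rewrite -big_split; apply/eq_bigr => a _; rewrite -big_split; apply/eq_bigr => b _.
by rewrite mcoeffD mulrDl mulrDr monalgUD.
Qed.

Lemma convDr w : right_distributive (conv w) +%R.
Proof.
move=> r p q.
rewrite (convEw w (fsubset_refl (msupp r)) (msuppD_le p q)).
rewrite (convEw w (fsubset_refl (msupp r)) (fsubsetUl (msupp p) (msupp q))).
rewrite (convEw w (fsubset_refl (msupp r)) (fsubsetUr (msupp p) (msupp q))).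
rewrite -big_split; apply/eq_bigr => a _; rewrite -big_split; apply/eq_bigr => b _.
by rewrite mcoeffD mulrDr mulrDr monalgUD.
Qed.

Lemma conv0l w : left_zero 0 (conv w).
Proof. by move=> q; rewrite conv.unlock msupp0 big_seq_fset0. Qed.

Lemma conv0r w : right_zero 0 (conv w).
Proof. by move=> p; rewrite conv.unlock msupp0 big1 // => a _; rewrite big_seq_fset0. Qed.

Lemma malgUZ (c d : F) (a : E) : << c * d *g a >> = c *: (<< d *g a >> : gralg E F).
Proof. by apply/malgP => k; rewrite mcoeff_grZ !mcoeffU mulrnAr. Qed.

Lemma msupp_grZ_le c p : (msupp (c *: p) `<=` msupp p)%fset.
Proof. by rewrite /GRing.scale /= gr_scale.unlock msuppZ_le. Qed.

Lemma convZl w c p q : conv w (c *: p) q = c *: conv w p q.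
Proof.
rewrite (convEw w (msupp_grZ_le c p) (fsubset_refl (msupp q))) conv.unlock scaler_sumr.
apply/eq_bigr => a _; rewrite scaler_sumr; apply/eq_bigr => b _.
by rewrite mcoeff_grZ -malgUZ; congr << _ *g _ >>; rewrite -mulrA mulrCA.
Qed.

Lemma convZr w c p q : conv w p (c *: q) = c *: conv w p q.
Proof.
rewrite (convEw w (fsubset_refl (msupp p)) (msupp_grZ_le c q)) conv.unlock scaler_sumr.
apply/eq_bigr => a _; rewrite scaler_sumr; apply/eq_bigr => b _.
rewrite mcoeff_grZ -malgUZ; congr << _ *g _ >>.
by rewrite [p@_a * _]mulrCA; apply: mulrCA.
Qed.

Definition gr_mul : gralg E F -> gralg E F -> gralg E F := conv (fun _ _ => 1).
Definition gr_one : gralg E F := << 1 *g 0 >>.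

Lemma gr_mulUU c d a b :
  gr_mul << c *g a >> << d *g b >> = << c * d *g a + b >>.
Proof. by rewrite /gr_mul convUU mul1r. Qed.

Lemma gr_mulA : associative gr_mul.
Proof.
rewrite /gr_mul => p q r; elim/malg_ind: p => [|c a|p1 p2 IH1 IH2].
- by rewrite !conv0l.
- elim/malg_ind: q => [|d b|q1 q2 IH1 IH2].
  + by rewrite !(conv0l, conv0r).
  + elim/malg_ind: r => [|e k|r1 r2 IH1 IH2].
    * by rewrite !conv0r.
    * by rewrite -!/gr_mul !gr_mulUU mulrA addrA.
    * by rewrite !convDr IH1 IH2.
  + by rewrite !(convDl, convDr) IH1 IH2.
- by rewrite !convDl IH1 IH2.
Qed.

Lemma gr_mulC : commutative gr_mul.
Proof.
rewrite /gr_mul => p q; elim/malg_ind: p => [|c a|p1 p2 IH1 IH2].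
- by rewrite conv0l conv0r.
- elim/malg_ind: q => [|d b|q1 q2 IH1 IH2].
  + by rewrite conv0l conv0r.
  + by rewrite -!/gr_mul !gr_mulUU mulrC addrC.
  + by rewrite convDl convDr IH1 IH2.
- by rewrite convDl convDr IH1 IH2.
Qed.

Lemma gr_mul1 : left_id gr_one gr_mul.
Proof.
rewrite /gr_mul; elim/malg_ind => [|c a|p1 p2 IH1 IH2].
- by rewrite conv0r.
- by rewrite -/gr_mul gr_mulUU mul1r add0r.
- by rewrite convDr IH1 IH2.
Qed.

Lemma gr_one_neq0 : gr_one != 0.
Proof. by rewrite monalgU_eq0 oner_eq0. Qed.

End Convolution.

HB.instance Definition _ (E : zmodType) (F : fieldType) :=
  GRing.Zmodule_isComNzRing.Build (gralg E F)
    (@gr_mulA E F) (@gr_mulC E F) (@gr_mul1 E F) (@convDl E F _)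
    (@gr_one_neq0 E F).

Lemma gr_scaleAl (E : zmodType) (F : fieldType) (c : F) (p q : gralg E F) :
  c *: (p * q) = c *: p * q.
Proof. by rewrite [RHS]convZl. Qed.

HB.instance Definition _ (E : zmodType) (F : fieldType) :=
  GRing.Lmodule_isLalgebra.Build F (gralg E F) (@gr_scaleAl E F).
HB.instance Definition _ (E : zmodType) (F : fieldType) :=
  GRing.Lalgebra_isComAlgebra.Build F (gralg E F).

(* Inverses are chosen classically, so that Laurent monomials can be written
   with the generic [_^-1]; see [zpowN] for their value. *)
Section Units.
Variables (E : zmodType) (F : fieldType).
Implicit Types p q : gralg E F.

Definition gr_unit : pred (gralg E F) := fun p => `[< exists q, q * p = 1 >].

Definition gr_inv p : gralg E F :=
  if pselect (exists q, q * p = 1) is left h then projT1 (cid h) else p.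

Lemma gr_mulV : {in gr_unit, left_inverse 1 gr_inv *%R}.
Proof.
move=> p /asboolP h; rewrite /gr_inv; case: pselect => // h'.
by case: (cid h').
Qed.

Lemma gr_unitP p q : q * p = 1 -> gr_unit p.
Proof. by move=> qp; apply/asboolP; exists q. Qed.

Lemma gr_inv_out : {in [predC gr_unit], gr_inv =1 id}.
Proof.
move=> p; rewrite inE => /asboolPn h; rewrite /gr_inv.
by case: pselect => // h'; case: h.
Qed.

End Units.

HB.instance Definition _ (E : zmodType) (F : fieldType) :=
  GRing.ComNzRing_hasMulInverse.Build (gralg E F)
    (@gr_mulV E F) (@gr_unitP E F) (@gr_inv_out E F).

(* The Laurent monomial z^a. *)
HB.lock Definition zpow (E : zmodType) (F : fieldType) (a : E) : gralg E F :=
  << 1 *g a >>.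

Section MonomialTheory.
Variables (E : zmodType) (F : fieldType).
Local Notation zpow := (@zpow E F).

Lemma malgU_zpow (c : F) a : << c *g a >> = c *: zpow a :> gralg E F.
Proof. by rewrite zpow.unlock -malgUZ mulr1. Qed.

Lemma msupp_zpow a : msupp (zpow a) = [fset a]%fset.
Proof. by rewrite zpow.unlock msuppU oner_eq0. Qed.

Lemma conv_zpow w a b : conv w (zpow a) (zpow b) = w a b *: zpow (a + b).
Proof. by rewrite -malgU_zpow zpow.unlock convUU !mulr1. Qed.

Lemma zpow0 : zpow 0 = 1. Proof. by rewrite zpow.unlock. Qed.

Lemma zpowD a b : zpow (a + b) = zpow a * zpow b.
Proof. by rewrite [RHS]conv_zpow scale1r. Qed.

Lemma zpow_unit a : zpow a \is a GRing.unit.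
Proof. by apply/unitrPr; exists (zpow (- a)); rewrite -zpowD subrr zpow0. Qed.

Lemma zpowN a : zpow (- a) = (zpow a)^-1.
Proof.
by apply: (mulrI (zpow_unit a)); rewrite mulrV ?zpow_unit // -zpowD subrr zpow0.
Qed.

Lemma zpowMn a n : zpow (a *+ n) = zpow a ^+ n.
Proof.
by elim: n => [|n IH]; rewrite ?mulr0n ?zpow0 // mulrS exprS zpowD IH.
Qed.

Lemma gr_ind (Q : gralg E F -> Prop) :
  Q 0 -> (forall a, Q (zpow a)) -> (forall c p, Q p -> Q (c *: p)) ->
  (forall p q, Q p -> Q q -> Q (p + q)) -> forall p, Q p.
Proof.
move=> Q0 QU QZ QD; apply: malg_ind => // c a.
by rewrite malgU_zpow; apply: QZ.
Qed.

End MonomialTheory.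

(* Functoriality of the group algebra. *)
Section GrMap.
Variables (E E' : zmodType) (F : fieldType) (h : {additive E -> E'}).

Definition gr_map : gralg E F -> gralg E' F := malg_push (G := F) h.

Lemma gr_map_zpow a : gr_map (zpow F a) = zpow F (h a).
Proof. by rewrite !zpow.unlock; apply: malg_pushU. Qed.

Lemma gr_map_is_additive : zmod_morphism gr_map.
Proof. exact: malg_push_is_additive. Qed.
HB.instance Definition _ :=
  GRing.isZmodMorphism.Build (gralg E F) (gralg E' F) gr_map gr_map_is_additive.

Lemma gr_map_is_scalable : scalable gr_map.
Proof.
move=> c p; elim/gr_ind: p c => [|a|d p IH|p q IHp IHq] c.
- by rewrite scaler0 raddf0 scaler0.
- by rewrite gr_map_zpow -!malgU_zpow; apply: malg_pushU.
- by rewrite scalerA !IH scalerA.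
- by rewrite scalerDr !raddfD /= IHp IHq.
Qed.
HB.instance Definition _ :=
  GRing.isScalable.Build F (gralg E F) (gralg E' F) *:%R gr_map gr_map_is_scalable.

Lemma gr_map_is_monoid_morphism : monoid_morphism gr_map.
Proof.
split; first by rewrite -[1 in LHS](zpow0 E F) gr_map_zpow raddf0 zpow0.
move=> p q; elim/gr_ind: p => [|a|c p IH|p1 p2 IH1 IH2].
- by rewrite mul0r raddf0 mul0r.
- elim/gr_ind: q => [|b|c q IH|q1 q2 IH1 IH2].
  + by rewrite mulr0 raddf0 mulr0.
  + by rewrite -zpowD !gr_map_zpow raddfD zpowD.
  + by rewrite -scalerAr !linearZ /= IH scalerAr.
  + by rewrite mulrDr !raddfD /= IH1 IH2 mulrDr.
- by rewrite -scalerAl !linearZ /= IH scalerAl.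
- by rewrite mulrDl !raddfD /= IH1 IH2 mulrDl.
Qed.
HB.instance Definition _ :=
  GRing.isMonoidMorphism.Build (gralg E F) (gralg E' F) gr_map
    gr_map_is_monoid_morphism.

End GrMap.

(* [inl i] stands for x_i and [inr i] for y_i. *)
Definition gen : Type := (int + int)%type.
HB.instance Definition _ := Choice.on gen.

(* Finitely supported exponent vectors: the free abelian group on [gen]. *)
Definition expo : Type := {malg int[gen]}.
HB.instance Definition _ := GRing.Zmodule.on expo.

HB.lock Definition gexp (u : gen) : expo := << 1 *g u >>.

(* The Laurent polynomial ring F[x_i^{+-1}, y_i^{+-1}, i in Z]. *)
Definition laurent (F : fieldType) := gralg expo F.

Lemma expo_ind (Q : expo -> Prop) :
  Q 0 -> (forall u, Q (gexp u)) -> (forall a, Q a -> Q (- a)) ->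
  (forall a b, Q a -> Q b -> Q (a + b)) -> forall a, Q a.
Proof.
move=> Q0 QU QN QD; apply: malg_ind => // n u.
have Qn m : Q (<< m%:Z *g u >>).
  elim: m => [|m IH]; first by rewrite monalgU0.
  by rewrite intS monalgUD; apply: QD => //; have := QU u; rewrite gexp.unlock.
by case: n => m; [apply: Qn | rewrite NegzE monalgUN; apply/QN/Qn].
Qed.

(* Additive extension to exponent vectors of an integer valued function. *)
Definition expo_ext (f : gen -> int) (a : expo) : int :=
  \sum_(u <- msupp a) a@_u * f u.

Lemma expo_extEw f (d : {fset gen}) (a : expo) :
  (msupp a `<=` d)%fset -> expo_ext f a = \sum_(u <- d) a@_u * f u.
Proof.
move=> le; rewrite /expo_ext (big_fset_incl _ le) //= => u _ /mcoeff_outdom ->.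
by rewrite mul0r.
Qed.

Lemma expo_ext_is_additive f : zmod_morphism (expo_ext f).
Proof.
move=> a b.
rewrite (expo_extEw f (msuppB_le a b)).
rewrite (expo_extEw f (fsubsetUl (msupp a) (msupp b))).
rewrite (expo_extEw f (fsubsetUr (msupp a) (msupp b))).
by rewrite -sumrB; apply: eq_bigr => u _; rewrite mcoeffB mulrBl.
Qed.
HB.instance Definition _ f :=
  GRing.isZmodMorphism.Build expo int (expo_ext f) (expo_ext_is_additive f).

Lemma expo_ext_gexp f u : expo_ext f (gexp u) = f u.
Proof. by rewrite gexp.unlock (expo_extEw f msuppU_le) big_seq_fset1 mcoeffUU mul1r. Qed.

Definition gdeg (u : gen) : int := if u is inl _ then 1 else - 1.

Definition edeg (a : expo) : int := expo_ext gdeg a.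

(* {z_u, z_v} = (omega u v) z_u z_v for generators z_u, z_v. *)
Definition omega (u v : gen) : int :=
  match u, v with
  | inl i, inl j => Num.sg (j - i)
  | inr i, inr j => Num.sg (j - i)
  | inl i, inr j => if i <= j then - 1 else 1
  | inr i, inl j => if j <= i then 1 else - 1
  end.

Lemma omegaC u v : omega u v = - omega v u.
Proof.
case: u v => [i|i] [j|j] /=; rewrite -?sgrN ?opprB //;
  by case: ifP; rewrite ?opprK.
Qed.

Definition eomega (a b : expo) : int := expo_ext (fun u => expo_ext (omega u) b) a.

Lemma eomegaDl b : {morph eomega^~ b : a1 a2 / a1 + a2}.
Proof. by move=> a1 a2; rewrite /eomega raddfD. Qed.

Lemma eomegaDr a : {morph eomega a : b1 b2 / b1 + b2}.
Proof.
move=> b1 b2; rewrite /eomega /expo_ext -big_split; apply: eq_bigr => u _ /=.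
by rewrite -mulrDr; congr (_ * _); rewrite -!/(expo_ext _ _) raddfD.
Qed.

Lemma eomega_gexp u b : eomega (gexp u) b = expo_ext (omega u) b.
Proof. by rewrite /eomega expo_ext_gexp. Qed.

Lemma eomega_gexp2 u v : eomega (gexp u) (gexp v) = omega u v.
Proof. by rewrite eomega_gexp expo_ext_gexp. Qed.

Lemma eomegaC a b : eomega a b = - eomega b a.
Proof.
rewrite /eomega /expo_ext -sumrN.
under eq_bigr do rewrite mulr_sumr.
rewrite exchange_big; apply: eq_bigr => v _ /=; rewrite mulr_sumr -sumrN.
by apply: eq_bigr => u _; rewrite [omega u v]omegaC !mulrN mulrCA.
Qed.

Section LaurentRing.
Variable F : fieldType.
Local Notation L := (laurent F).
Implicit Types P Q S : L.

Definition lx (i : int) : L := zpow F (gexp (inl i)).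
Definition ly (i : int) : L := zpow F (gexp (inr i)).

(* [homog d P]: P is homogeneous of degree d for deg x_i = 1 = - deg y_i. *)
Definition homog (d : int) (P : L) : Prop := forall a, a \in msupp P -> edeg a = d.

(* The bracket is log-canonical: {z^a, z^b} = (eomega a b) z^(a + b). See
   [pbracket_spec] and [pbracket_unique] for its characterization. *)
Definition pbracket (P Q : L) : L := conv (fun a b => (eomega a b)%:~R) P Q.


Definition is_poisson_bracket (br : L -> L -> L) : Prop :=
  [/\ forall c P P' Q, br (c *: P + P') Q = c *: br P Q + br P' Q,
      forall P Q, br P Q = - br Q P,
      forall P Q S, br P (Q * S) = br P Q * S + Q * br P S &
      forall P Q S, br P (br Q S) + br Q (br S P) + br S (br P Q) = 0].

Definition has_generator_brackets (br : L -> L -> L) : Prop :=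
  (forall i, br (lx i) (ly i) = - (lx i * ly i)) /\
  forall i j, i < j ->
    [/\ br (lx i) (lx j) = lx i * lx j,
        br (lx i) (ly j) = - (lx i * ly j),
        br (ly i) (ly j) = ly i * ly j &
        br (ly i) (lx j) = - (ly i * lx j)].

Lemma pbracket_zpow a b :
  pbracket (zpow F a) (zpow F b) = (eomega a b)%:~R *: zpow F (a + b).
Proof. exact: conv_zpow. Qed.

Lemma pbracket0l Q : pbracket 0 Q = 0. Proof. exact: conv0l. Qed.
Lemma pbracket0r P : pbracket P 0 = 0. Proof. exact: conv0r. Qed.
Lemma pbracketDl P P' Q : pbracket (P + P') Q = pbracket P Q + pbracket P' Q.
Proof. exact: convDl. Qed.
Lemma pbracketDr P Q Q' : pbracket P (Q + Q') = pbracket P Q + pbracket P Q'.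
Proof. exact: convDr. Qed.
Lemma pbracketZl c P Q : pbracket (c *: P) Q = c *: pbracket P Q.
Proof. exact: convZl. Qed.
Lemma pbracketZr c P Q : pbracket P (c *: Q) = c *: pbracket P Q.
Proof. exact: convZr. Qed.

Lemma pbracketC P Q : pbracket P Q = - pbracket Q P.
Proof.
elim/gr_ind: P => [|a|c P IH|P P' IH IH'].
- by rewrite pbracket0l pbracket0r oppr0.
- elim/gr_ind: Q => [|b|c Q IH|Q Q' IH IH'].
  + by rewrite pbracket0l pbracket0r oppr0.
  + by rewrite !pbracket_zpow eomegaC addrC rmorphN scaleNr.
  + by rewrite pbracketZl pbracketZr IH scalerN.
  + by rewrite pbracketDl pbracketDr IH IH' opprD.
- by rewrite pbracketZl pbracketZr IH scalerN.
- by rewrite pbracketDl pbracketDr IH IH' opprD.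
Qed.

Let mulZl c P Q : (c *: P) * Q = c *: (P * Q).
Proof. by rewrite scalerAl. Qed.
Let mulZr c P Q : P * (c *: Q) = c *: (P * Q).
Proof. by rewrite scalerAr. Qed.

Lemma pbracket_leibniz P Q S :
  pbracket P (Q * S) = pbracket P Q * S + Q * pbracket P S.
Proof.
elim/gr_ind: P => [|a|c P IH|P P' IH IH'].
- by rewrite !pbracket0l mul0r mulr0 addr0.
- elim/gr_ind: Q => [|b|c Q IH|Q Q' IH IH'].
  + by rewrite !(pbracket0l, pbracket0r, mul0r, addr0).
  + elim/gr_ind: S => [|d|c S IH|S S' IH IH'].
    * by rewrite !(pbracket0l, pbracket0r, mulr0, addr0).
    * rewrite -zpowD !pbracket_zpow eomegaDr rmorphD scalerDl.
      by rewrite mulZl mulZr -!zpowD addrA [b + (a + d)]addrCA addrA.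
    * by rewrite mulZr !pbracketZr !mulZr -scalerDr -IH.
    * by rewrite !(mulrDr, pbracketDr) IH IH' addrACA.
  + by rewrite mulZl !pbracketZr !mulZl -scalerDr -IH.
  + by rewrite !(mulrDl, pbracketDr) IH IH' addrACA.
- by rewrite !pbracketZl mulZl mulZr -scalerDr -IH.
- by rewrite !pbracketDl IH IH' mulrDl mulrDr addrACA.
Qed.

Lemma pbracket_jacobi P Q S :
  pbracket P (pbracket Q S) + pbracket Q (pbracket S P) +
  pbracket S (pbracket P Q) = 0.
Proof.
elim/gr_ind: P => [|a|c P IH|P P' IH IH'].
- by rewrite !(pbracket0l, pbracket0r, addr0).
- elim/gr_ind: Q => [|b|c Q IH|Q Q' IH IH'].
  + by rewrite !(pbracket0l, pbracket0r, addr0).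
  + elim/gr_ind: S => [|d|c S IH|S S' IH IH'].
    * by rewrite !(pbracket0l, pbracket0r, addr0).
    * rewrite !(pbracket_zpow, pbracketZr) !scalerA.
      rewrite [b + (d + a)]addrC -[d + a + b]addrA [d + (a + b)]addrC -addrA.
      rewrite [b + d]addrC [d + a]addrC !eomegaDr.
      rewrite [a + (d + b)]addrA [a + d + b]addrAC -[a + b + d]addrA -!scalerDl.
      rewrite -!rmorphM -!rmorphD /=.
      rewrite [eomega b a]eomegaC [eomega d a]eomegaC [eomega d b]eomegaC.
      set u := eomega a b; set v := eomega a d; set w := eomega b d.
      have -> : w * (v + u) + (- v * (- u + w) + u * (- v - w)) = 0 by ring.
      by rewrite scale0r.
    * by rewrite !(pbracketZl, pbracketZr) -!scalerDr IH scaler0.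
    * rewrite !(pbracketDl, pbracketDr) [X in X + _ = _]addrACA.
      by rewrite [LHS]addrACA IH IH' addr0.
  + by rewrite !(pbracketZl, pbracketZr) -!scalerDr IH scaler0.
  + rewrite !(pbracketDl, pbracketDr) [X in X + _ = _]addrACA.
    by rewrite [LHS]addrACA IH IH' addr0.
- by rewrite !(pbracketZl, pbracketZr) -!scalerDr IH scaler0.
- rewrite !(pbracketDl, pbracketDr) [X in X + _ = _]addrACA.
  by rewrite [LHS]addrACA IH IH' addr0.
Qed.

Lemma pbracket_gen u v :
  pbracket (zpow F (gexp u)) (zpow F (gexp v)) =
  (omega u v)%:~R *: (zpow F (gexp u) * zpow F (gexp v)).
Proof. by rewrite pbracket_zpow eomega_gexp2 zpowD. Qed.

Lemma pbracket_spec : is_poisson_bracket pbracket /\ has_generator_brackets pbracket.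
Proof.
split; split.
- by move=> c P P' Q; rewrite pbracketDl pbracketZl.
- exact: pbracketC.
- exact: pbracket_leibniz.
- exact: pbracket_jacobi.
- by move=> i; rewrite /lx /ly pbracket_gen /= lexx rmorphN scaleNr scale1r.
- move=> i j ij; rewrite /lx /ly !pbracket_gen /= gtr0_sg ?subr_gt0 //.
  by rewrite (ltW ij) leNgt ij /= rmorphN !scaleNr !scale1r.
Qed.

Lemma deriv_eq0 (D : L -> L) :
  (forall c P Q, D (c *: P + Q) = c *: D P + D Q) ->
  (forall P Q, D (P * Q) = D P * Q + P * D Q) ->
  (forall i, D (lx i) = 0) -> (forall i, D (ly i) = 0) -> forall P, D P = 0.
Proof.
move=> Dlin Dmul Dx Dy.
have D1 : D 1 = 0.
  by have := Dmul 1 1; rewrite !mulr1 mul1r -[LHS]addr0 => /addrI.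
have D0 : D 0 = 0.
  by have := Dlin 1 0 0; rewrite scaler0 addr0 scale1r -[LHS]addr0 => /addrI.
apply: gr_ind => // [|c P IH|P Q IH IH']; first 1 last.
- by rewrite -[_ *: _]addr0 Dlin IH D0 scaler0 addr0.
- by rewrite -[P]scale1r Dlin IH IH' scaler0 addr0.
apply: expo_ind => [|[i|i]|a IH|a b IHa IHb].
- by rewrite zpow0.
- exact: Dx.
- exact: Dy.
- have := Dmul (zpow F a) (zpow F (- a)).
  rewrite -zpowD subrr zpow0 D1 IH mul0r add0r -[LHS](mulr0 (zpow F a)).
  by move/(mulrI (zpow_unit F a)).
- by rewrite zpowD Dmul IHa IHb mul0r mulr0 addr0.
Qed.

Lemma pbracket_unique (br : L -> L -> L) : 2%:R != 0 :> F ->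
  is_poisson_bracket br -> has_generator_brackets br -> br =2 pbracket.
Proof.
move=> F2 [brl brC brM _] [brxy brlt].
have [[pl pC pM _] [pxy plt]] := pbracket_spec.
have brr c P Q Q' : br P (c *: Q + Q') = c *: br P Q + br P Q'.
  by rewrite brC brl opprD -scalerN -!brC.
have pr c P Q Q' : pbracket P (c *: Q + Q') = c *: pbracket P Q + pbracket P Q'.
  by rewrite pbracketDr pbracketZr.
have ext P : (forall i, br P (lx i) = pbracket P (lx i)) ->
    (forall i, br P (ly i) = pbracket P (ly i)) -> br P =1 pbracket P.
  move=> hx hy Q; apply/eqP; rewrite -subr_eq0; apply/eqP.
  apply: (@deriv_eq0 (fun Q => br P Q - pbracket P Q)) => [c S S'|S S'|i|i].
  - by rewrite brr pr opprD addrACA -scalerBr.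
  - by rewrite brM pM opprD addrACA -mulrBl -mulrBr.
  - by rewrite hx subrr.
  - by rewrite hy subrr.
have self (b : L -> L -> L) P : (forall Q S, b Q S = - b S Q) -> b P P = 0.
  move=> bC; have : 2%:R *: b P P = 0.
    by rewrite scaler_nat mulr2n {1}bC addNr.
  by move/eqP; rewrite scaler_eq0 (negPf F2) => /eqP.
have xx i j : br (lx i) (lx j) = pbracket (lx i) (lx j).
  case: (ltgtP i j) => [ij|ij|->].
  - by have [-> _ _ _] := brlt _ _ ij; have [-> _ _ _] := plt _ _ ij.
  - rewrite brC pC; congr (- _).
    by have [-> _ _ _] := brlt _ _ ij; have [-> _ _ _] := plt _ _ ij.
  - by rewrite !self.
have yy i j : br (ly i) (ly j) = pbracket (ly i) (ly j).
  case: (ltgtP i j) => [ij|ij|->].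
  - by have [_ _ -> _] := brlt _ _ ij; have [_ _ -> _] := plt _ _ ij.
  - rewrite brC pC; congr (- _).
    by have [_ _ -> _] := brlt _ _ ij; have [_ _ -> _] := plt _ _ ij.
  - by rewrite !self.
have xy i j : br (lx i) (ly j) = pbracket (lx i) (ly j).
  case: (ltgtP i j) => [ij|ij|->].
  - by have [_ -> _ _] := brlt _ _ ij; have [_ -> _ _] := plt _ _ ij.
  - rewrite brC pC; congr (- _).
    by have [_ _ _ ->] := brlt _ _ ij; have [_ _ _ ->] := plt _ _ ij.
  - by rewrite brxy pxy.
have yx i j : br (ly i) (lx j) = pbracket (ly i) (lx j) by rewrite brC pC xy.
by move=> P Q; apply: (ext) => i; rewrite brC pC; congr (- _); apply: ext.
Qed.

(* The F-algebra endomorphism with z_u |-> z_(s u). *)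
Definition rename (s : gen -> gen) : L -> L :=
  gr_map (malg_push (G := int) s : {additive expo -> expo}).
HB.instance Definition _ s := GRing.LRMorphism.on (rename s).

Lemma rename_zpow s (a : expo) :
  rename s (zpow F a) = zpow F (malg_push (G := int) s a : expo).
Proof. exact: gr_map_zpow. Qed.

Lemma push_gexp s u : malg_push (G := int) s (gexp u) = gexp (s u) :> expo.
Proof. by rewrite gexp.unlock malg_pushU. Qed.

Lemma rename_gexp s u : rename s (zpow F (gexp u)) = zpow F (gexp (s u)).
Proof. by rewrite rename_zpow push_gexp. Qed.

Lemma rename_unique (f : {lrmorphism L -> L}) s :
  (forall u, f (zpow F (gexp u)) = zpow F (gexp (s u))) -> f =1 rename s.
Proof.
move=> fs; apply: gr_ind => [|a|c P IH|P Q IHP IHQ].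
- by rewrite !raddf0.
- move: a; apply: expo_ind => [|u|a IH|a b IHa IHb].
  + by rewrite !zpow0 !rmorph1.
  + by rewrite fs rename_gexp.
  + by rewrite !zpowN !rmorphV ?zpow_unit // /= IH.
  + by rewrite !zpowD !rmorphM /= IHa IHb.
- by rewrite !linearZ /= IH.
- by rewrite !raddfD /= IHP IHQ.
Qed.

Lemma rename_comp s t : rename s \o rename t =1 rename (s \o t).
Proof.
apply: (@rename_unique (rename s \o rename t : {lrmorphism L -> L})) => u /=.
by rewrite !rename_gexp.
Qed.

Lemma rename_bij s : bijective s -> bijective (rename s).
Proof.
move=> [t st ts].
have K s' t' : cancel s' t' -> cancel (rename s') (rename t').
  move=> st' P; rewrite -[LHS]/((rename t' \o rename s') P) rename_comp.
  symmetry; apply: (@rename_unique (idfun : {lrmorphism L -> L})) => u /=.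
  by rewrite st'.
by exists (rename t); apply: K.
Qed.

Definition shift (u : gen) : gen :=
  match u with inl i => inl (i + 1) | inr i => inr (i + 1) end.

Definition half_shift (u : gen) : gen :=
  match u with inl i => inr i | inr i => inl (i + 1) end.

Definition T : L -> L := rename shift.
HB.instance Definition _ := GRing.LRMorphism.on T.

Definition Thalf : L -> L := rename half_shift.
HB.instance Definition _ := GRing.LRMorphism.on Thalf.

Lemma T_lx i : T (lx i) = lx (i + 1). Proof. exact: rename_gexp. Qed.
Lemma T_ly i : T (ly i) = ly (i + 1). Proof. exact: rename_gexp. Qed.
Lemma Thalf_lx i : Thalf (lx i) = ly i. Proof. exact: rename_gexp. Qed.
Lemma Thalf_ly i : Thalf (ly i) = lx (i + 1). Proof. exact: rename_gexp. Qed.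

Lemma T_bij : bijective T.
Proof.
apply: rename_bij.
exists (fun u => match u with inl i => inl (i - 1) | inr i => inr (i - 1) end).
  by case=> i /=; rewrite addrK.
by case=> i /=; rewrite subrK.
Qed.

Lemma Thalf_bij : bijective Thalf.
Proof.
apply: rename_bij.
exists (fun u => match u with inl i => inr (i - 1) | inr i => inl i end).
  by case=> i //=; rewrite addrK.
by case=> i //=; rewrite subrK.
Qed.

(* The sums over Z have finitely many nonzero terms when P is homogeneous of
   degree 0 ([finite_br_lx], [finite_br_ly]); a sum over an infinite support is
   0 by convention, so the values are meaningful for such P only.
   Sp_bracket P = {Sigma+, P}, Sm_bracket P = {Sigma-, P}, and
   bracket_Sm P = {P, Sigma-}. *)
Definition Sp_bracket (P : L) : L := \sum_(i \in [set: int]) pbracket (lx i) P.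
Definition Sm_bracket (P : L) : L := \sum_(i \in [set: int]) pbracket (ly i) P.
Definition bracket_Sm (P : L) : L := - Sm_bracket P.

Definition in_im_T_sub_id (P : L) : Prop := exists Q : L, P = T Q - Q.

Definition motion_density (P : L) : Prop :=
  in_im_T_sub_id (Sp_bracket P) /\ in_im_T_sub_id (Sm_bracket P).

Definition gidx (u : gen) : int := match u with inl i => i | inr i => i end.

Lemma pbracket_gen_eq0 u P :
  (forall a, a \in msupp P -> expo_ext (omega u) a = 0) ->
  pbracket (zpow F (gexp u)) P = 0.
Proof.
move=> h; rewrite /pbracket conv.unlock msupp_zpow big_seq_fset1.
rewrite big_seq big1 // => a /h a0.
by rewrite eomega_gexp a0 mul0r monalgU0.
Qed.

Lemma expo_ext_omega0 u c (a : expo) :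
  (forall v, v \in msupp a -> omega u v = c * gdeg v) -> edeg a = 0 ->
  expo_ext (omega u) a = 0.
Proof.
move=> h a0; rewrite /expo_ext big_seq.
under eq_bigr => v va do rewrite h // mulrCA.
by rewrite -big_seq -mulr_sumr -[X in c * X]/(edeg a) a0 mulr0.
Qed.

Lemma gidx_bounded P : exists M : nat, forall a v,
  a \in msupp P -> v \in msupp (a : expo) -> `|gidx v| <= M%:Z.
Proof.
exists (\sum_(a <- msupp P) \sum_(v <- msupp (a : expo)) `|gidx v|)%N => a v aP va.
rewrite -abszE lez_nat (big_fsetD1 a) //= (big_fsetD1 v) //=.
by rewrite -addnA leq_addr.
Qed.

Lemma finite_int_le (M : nat) : finite_set [set i : int | `|i| <= M%:Z].
Proof.
apply: (@sub_finite_set _ _ [set k%:Z - M%:Z | k in `I_((2 * M).+1)])%classic.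
  move=> i /=; rewrite ler_norml => /andP[iM Mi].
  have i0 : 0 <= i + M%:Z by rewrite -lerBlDr sub0r.
  exists (absz (i + M%:Z)%R); last by rewrite gez0_abs // addrK.
  by rewrite /= ltnS -lez_nat gez0_abs // mul2n -addnn PoszD lerD2r.
exact: finite_image (finite_II _).
Qed.

Lemma finite_br_gen (g : int -> gen) (c : int) P :
  (forall i v, gidx v < i -> omega (g i) v = c * gdeg v) ->
  (forall i v, i < gidx v -> omega (g i) v = - c * gdeg v) ->
  homog 0 P -> finite_set [set i | pbracket (zpow F (gexp (g i))) P != 0].
Proof.
move=> hlt hgt P0; have [M PM] := gidx_bounded P.
apply: sub_finite_set (finite_int_le M) => i /=; apply: contraNT.
rewrite -ltNge ltr_normr => /orP[Mi|Mi]; apply/eqP/pbracket_gen_eq0 => a aP;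
    [apply: (@expo_ext_omega0 _ c)|apply: (@expo_ext_omega0 _ (- c))];
    (try exact: P0) => v va; have := PM _ _ aP va; rewrite ler_norml => /andP[l r].
- by apply: hlt; apply: le_lt_trans r Mi.
- by apply: hgt; rewrite (lt_le_trans _ l) // ltrNr.
Qed.

Lemma finite_br_lx P : homog 0 P -> finite_set [set i | pbracket (lx i) P != 0].
Proof.
apply: (@finite_br_gen inl (- 1)) => i [j|j] /= ij.
- by rewrite ltr0_sg ?subr_lt0 // mulr1.
- by rewrite leNgt ij /= mulrNN.
- by rewrite gtr0_sg ?subr_gt0 // opprK mulr1.
- by rewrite (ltW ij) opprK mul1r.
Qed.

Lemma finite_br_ly P : homog 0 P -> finite_set [set i | pbracket (ly i) P != 0].
Proof.
apply: (@finite_br_gen inr 1) => i [j|j] /= ij.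
- by rewrite (ltW ij) mulr1.
- by rewrite ltr0_sg ?subr_lt0 // mul1r.
- by rewrite leNgt ij /= mulr1.
- by rewrite gtr0_sg ?subr_gt0 // mulrNN.
Qed.

Lemma homog0 d : homog d 0.
Proof. by move=> a; rewrite msupp0. Qed.

Lemma homogD d P Q : homog d P -> homog d Q -> homog d (P + Q).
Proof.
move=> hP hQ a /(fsubsetP (msuppD_le P Q)); rewrite in_fsetU.
by case/orP => [/hP|/hQ].
Qed.

Lemma homogZ d c P : homog d P -> homog d (c *: P).
Proof. by move=> hP a /(fsubsetP (msupp_grZ_le c P)) /hP. Qed.

Lemma homog_zpow a : homog (edeg a) (zpow F a).
Proof. by move=> b; rewrite msupp_zpow inE => /eqP ->. Qed.

Lemma homog_sum d (I : Type) (r : seq I) (p : pred I) (f : I -> L) :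
  (forall i, p i -> homog d (f i)) -> homog d (\sum_(i <- r | p i) f i).
Proof.
by move=> h; apply: big_ind => //; [apply: homog0 | apply: homogD].
Qed.

Lemma gr_sum_zpow P : P = \sum_(a <- msupp P) P@_a *: zpow F a.
Proof. by rewrite {1}[P]monalgE; apply: eq_bigr => a _; rewrite malgU_zpow. Qed.

Lemma edeg_half (a : expo) :
  edeg (malg_push (G := int) half_shift a) = - edeg a.
Proof.
move: a; apply: expo_ind => [|u|a IH|a b IHa IHb].
- by rewrite /edeg !raddf0.
- by rewrite push_gexp /edeg !expo_ext_gexp; case: u.
- by rewrite /edeg !raddfN /= -!/(edeg _) IH.
- by rewrite /edeg !raddfD /= -!/(edeg _) IHa IHb.
Qed.

Lemma homog_Thalf d P : homog d P -> homog (- d) (Thalf P).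
Proof.
move=> hP; rewrite {1}[P]gr_sum_zpow raddf_sum /= big_seq.
apply: homog_sum => a aP; rewrite linearZ /=; apply: homogZ.
by rewrite /Thalf rename_zpow -(hP a aP) -edeg_half; apply: homog_zpow.
Qed.

(* Equals 1 for p = 0 even when m < 0. *)
Definition binomZ (m p : int) : nat :=
  if p == 0 then 1%N
  else if (p < 0) || (Num.max 0 m < p) then 0%N
  else 'C(`|m|, `|p|)%N.

(* A multi-index (alpha_1, ..., alpha_(2N-2)) of sum n has entries at most n,
   hence the finite type of entries. *)
Definition multi_index (n N : nat) : finType := (2 * N - 2).-tuple 'I_n.+1.

(* alpha_i, with i starting from 1. *)
Definition entry n N (alpha : multi_index n N) (i : nat) : nat :=
  nth 0%N (map val alpha) i.-1.

Definition multi_indices (n N : nat) : {set multi_index n N} :=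
  [set alpha | (1 <= entry alpha 1)%N &
               (\sum_(1 <= i < (2 * N - 2).+1) entry alpha i == n)%N].

Definition A'cl (n N : nat) : L :=
  \sum_(alpha in multi_indices n N)
    ((entry alpha 1)%:R^-1 *
     \prod_(1 <= i < (2 * N - 3).+1)
       (binomZ ((entry alpha i)%:Z + (entry alpha i.+1)%:Z - 1)
               (entry alpha i.+1)%:Z)%:R) *:
    \prod_(1 <= k < N)
      ((lx k%:Z * ly k%:Z) ^- entry alpha (2 * k - 1) *
       (ly k%:Z * lx (k%:Z + 1)) ^- entry alpha (2 * k)).

Definition B'cl (n N : nat) : L := Thalf (A'cl n N).

Definition psi'cl (n N : nat) : L := A'cl n N + B'cl n N.

Lemma homog_A'cl n N : homog 0 (A'cl n N).
Proof.
apply: homog_sum => alpha _; apply: homogZ.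
pose mon0 (m : L) := exists2 a, edeg a = 0 & m = zpow F a.
suff [a a0 ->] : mon0 (\prod_(1 <= k < N)
      ((lx k%:Z * ly k%:Z) ^- entry alpha (2 * k - 1) *
       (ly k%:Z * lx (k%:Z + 1)) ^- entry alpha (2 * k))).
  by rewrite -a0; apply: homog_zpow.
have mon0M m m' : mon0 m -> mon0 m' -> mon0 (m * m').
  move=> [a a0 ->] [b b0 ->]; exists (a + b); last by rewrite zpowD.
  by rewrite /edeg raddfD /= -!/(edeg _) a0 b0.
have mon0X m k : mon0 m -> mon0 (m ^- k).
  move=> [a a0 ->]; exists (- (a *+ k)); last by rewrite zpowN zpowMn.
  by rewrite /edeg raddfN raddfMn /= -/(edeg _) a0 mul0rn oppr0.
apply: big_ind => // [|k _]; first by exists 0; rewrite ?zpow0 // /edeg raddf0.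
apply: mon0M; apply: mon0X; rewrite /lx /ly -zpowD; eexists => //;
  by rewrite /edeg raddfD /= !expo_ext_gexp.
Qed.

Lemma homog_psi'cl n N : homog 0 (psi'cl n N).
Proof.
apply: homogD; first exact: homog_A'cl.
by rewrite -oppr0; apply/homog_Thalf/homog_A'cl.
Qed.

End LaurentRing.

(* Main.v *)
Require Import Defs.
From HB Require Import structures.
From mathcomp Require Import all_boot all_order all_algebra finmap.
From mathcomp Require Import boolp classical_sets functions cardinality fsbigop.
From mathcomp Require Import reals complex.
From mathcomp Require Import ring zify.

(** Write [z_1, z_2, z_3, z_4, ...] for [x_1, y_1, x_2, y_2, ...] and
    [u_k = 1 / (z_k z_(k+1))], so that the half shift maps [u_k] to [u_(k+1)].
    Let [q_k = 1 / (1 - t u_k q_(k+1))], a continued fraction in the formal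
    parameter [t]. Expanding the powers [q_k ^ a] with the negative binomial
    series, one level after the other, produces the binomial coefficients of
    [A'cl]: it is the coefficient of [t^n] in [log q_1] ([A'cl_cflog]), and
    [B'cl] is the coefficient of [t^n] in [log q_2].

    On functions of the [u_k], the bracket with Sigma+ is a derivation [D] with
    [D u_k = 1 / z_(k+1)] for odd [k] and [D u_k = - 1 / z_k] for even [k].
    Applied to the definition of [q_k], it gives
    [D q_k = t q_k^2 D (u_k q_(k+1))], and a short computation shows that the
    two rules

      [D q_k = z_k (q_k - 1)] for odd [k],
      [D q_k = - t q_k^2 / z_k] for even [k]

    pass from [k + 1] to [k]. Each step improves the precision in [t] by one
    power, so the rules hold to every order ([Dcfrac_eq]). They imply
    [D (log q_1) = t q_2 / z_2 = - D (log q_2)] ([D_cflog_pair]), which is the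
    vanishing of the bracket of Sigma+ with the density.

    The bracket with Sigma- follows by symmetry: the half shift [tau] preserves
    the Poisson bracket and exchanges Sigma+ and Sigma- up to a shift, so the
    equation [{Sigma+, A'} = - tau {Sigma-, A'}] just obtained gives
    [{Sigma-, A' + tau A'} = {Sigma-, A'} + tau {Sigma+, A'}
     = {Sigma-, A'} - tau^2 {Sigma-, A'}], and [tau^2 = T].

    Only finitely many variables occur in [A'cl], so the continued fractions are
    cut at a finite depth [d]. This changes [q_k] from order [t^(d+1)] on
    only, and the hypothesis [n <= 2 (N - 1)] is exactly what keeps the
    coefficient of [t^n] below the resulting error. All series are polynomials
    in [t], compared modulo a power of ['X]. *)

Set Implicit Arguments.
Unset Strict Implicit.
Unset Printing Implicit Defensive.

Import Order.TTheory GRing.Theory Num.Theory.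
Local Open Scope ring_scope.

(** * Congruences of polynomials modulo a power of the variable *)

Definition eqX (S : comNzRingType) (m : nat) (p q : {poly S}) : Prop :=
  exists r, p = q + 'X^m * r.

Section Congruence.
Variable S : comNzRingType.
Implicit Types p q r : {poly S}.

Lemma eqX0 p q : eqX 0 p q.
Proof. by exists (p - q); rewrite expr0; ring. Qed.

Lemma eqX_refl m p : eqX m p p.
Proof. by exists 0; rewrite mulr0 addr0. Qed.

Lemma eqX_sym m p q : eqX m p q -> eqX m q p.
Proof. by case=> r ->; exists (- r); ring. Qed.

Lemma eqX_trans m q p r : eqX m p q -> eqX m q r -> eqX m p r.
Proof. by case=> a -> [b ->]; exists (a + b); ring. Qed.

Lemma eqX_leq m n p q : (m <= n)%N -> eqX n p q -> eqX m p q.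
Proof.
by move=> mn [r ->]; exists ('X^(n - m) * r); rewrite mulrA -exprD subnKC.
Qed.

Lemma eqXM m p q p' q' : eqX m p q -> eqX m p' q' -> eqX m (p * p') (q * q').
Proof.
by case=> a -> [b ->]; exists (a * q' + q * b + 'X^m * a * b); ring.
Qed.

Lemma eqXMl m r p q : eqX m p q -> eqX m (r * p) (r * q).
Proof. exact/eqXM/eqX_refl. Qed.

Lemma eqXS m p q : eqX m p q -> eqX m.+1 ('X * p) ('X * q).
Proof. by case=> r ->; exists r; rewrite exprS; ring. Qed.

Lemma eqXD m p q p' q' : eqX m p q -> eqX m p' q' -> eqX m (p + p') (q + q').
Proof. by case=> a -> [b ->]; exists (a + b); ring. Qed.

Lemma eqX_exp m p q j : eqX m p q -> eqX m (p ^+ j) (q ^+ j).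
Proof.
move=> e; elim: j => [|j IH]; first exact: eqX_refl.
by rewrite !exprS; apply: eqXM.
Qed.

Lemma eqX_sum m (I : Type) (s : seq I) (P : pred I) (f g : I -> {poly S}) :
  (forall i, P i -> eqX m (f i) (g i)) ->
  eqX m (\sum_(i <- s | P i) f i) (\sum_(i <- s | P i) g i).
Proof.
move=> h; apply: (big_ind2 (eqX m)) => //; first exact: eqX_refl.
by move=> *; apply: eqXD.
Qed.

Lemma eqX_coef m p q i : (i < m)%N -> eqX m p q -> p`_i = q`_i.
Proof. by move=> im [r ->]; rewrite coefD coefXnM im addr0. Qed.

Definition geom (n : nat) p : {poly S} := \sum_(j < n) p ^+ j.

Lemma geom_inv n p : geom n p * (1 - p) = 1 - p ^+ n.
Proof. by rewrite -[RHS]opprB subrX1 /geom; ring. Qed.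

Lemma geom_invX n p : exists s, geom n ('X * p) * (1 - 'X * p) = 1 + 'X^n * s.
Proof. by rewrite geom_inv exprMn; exists (- p ^+ n); ring. Qed.

Lemma eqX_geom m n p q : eqX m p q -> eqX m (geom n p) (geom n q).
Proof. by move=> e; apply: eqX_sum => j _; apply: eqX_exp. Qed.

(** The series of [(1 - p) ^ - a], cut after [n] terms. *)
Definition newton (n a : nat) p : {poly S} := \sum_(j < n) p ^+ j *+ 'C((a + j).-1, j).

(** Pascal's rule makes multiplication by [1 - p] lower the exponent, up to the
    last term of the truncated sum. *)
Lemma newton_pascal n a p :
  exists r, newton n a.+1 p * (1 - p) = newton n a p - p ^+ n * r.
Proof.
case: n => [|n]; first by exists 0; rewrite /newton !big_ord0; ring.
exists (1 *+ 'C(a + n, n)).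
have -> : newton n.+1 a.+1 p = \sum_(j < n.+1) p ^+ j *+ 'C(a + j, j) by [].
have -> : newton n.+1 a p = \sum_(j < n.+1) p ^+ j *+ 'C(a + j, j)
                - p * (\sum_(j < n) p ^+ j *+ 'C(a + j, j)).
  rewrite /newton !big_ord_recl /= !bin0 mulr_sumr.
  rewrite -addrA; congr (_ + _); rewrite -sumrB; apply: eq_bigr => i _.
  rewrite /bump /= !addnS /= exprS -!mulrnAr -mulrBr; congr (_ * _).
  by rewrite binS mulrnDr addrK.
have -> : p ^+ n.+1 * (1 *+ 'C(a + n, n)) = p * (p ^+ n *+ 'C(a + n, n)).
  by rewrite exprS mulrnAr mulr1 mulrnAr.
by rewrite big_ord_recr /=; move: (p ^+ n) => pn; ring.
Qed.

Lemma newton0 n p : (0 < n)%N -> newton n 0 p = 1.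
Proof.
case: n => // n _; rewrite /newton big_ord_recl big1 ?addr0 ?bin0 // => i _.
by rewrite /bump /= bin_small ?mulr0n.
Qed.

(** The truncated binomial series is the power of the truncated geometric one,
    by induction on [a]: both are multiplied by the inverse of [1 - 'X * p]. *)
Lemma newton_geom n a p : eqX n (newton n a ('X * p)) (geom n ('X * p) ^+ a).
Proof.
have [s] := geom_invX n p; have := fun b => newton_pascal n b ('X * p).
rewrite [in X in X -> _]exprMn; set h := 'X * p; set q := geom n h => e es.
elim: a => [|a IH].
  have [n0|n_gt0] := posnP n; last by rewrite newton0 //; apply: eqX_refl.
  by exists (newton n 0 h - 1); rewrite {2}n0 !expr0; ring.
have [r er] := e a; rewrite exprS; apply: eqX_trans (eqXMl _ IH).
exists (- s * newton n a.+1 h - q * p ^+ n * r).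
have {1}-> : newton n a.+1 h =
    q * (newton n a.+1 h * (1 - h)) - 'X^n * s * newton n a.+1 h.
  have -> : q * (newton n a.+1 h * (1 - h)) = q * (1 - h) * newton n a.+1 h by ring.
  by rewrite es; ring.
by rewrite er; ring.
Qed.

End Congruence.

(** * Derivations acting on coefficients *)

Section Derivation.
Variables (S : comNzRingType) (D : {additive S -> S}).
Hypothesis D_leibniz : forall a b, D (a * b) = D a * b + a * D b.
Implicit Types p q : {poly S}.

Definition Dpoly p : {poly S} := map_poly D p.

Lemma coef_Dpoly p i : (Dpoly p)`_i = D p`_i.
Proof. by rewrite coef_map_id0 // raddf0. Qed.

Lemma DpolyB p q : Dpoly (p - q) = Dpoly p - Dpoly q.
Proof. by apply/polyP => i; rewrite !(coefB, coef_Dpoly) raddfB. Qed.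

Lemma DpolyM p q : Dpoly (p * q) = Dpoly p * q + p * Dpoly q.
Proof.
apply/polyP => i; rewrite coefD coef_Dpoly !coefM raddf_sum -big_split /=.
by apply: eq_bigr => j _; rewrite D_leibniz !coef_Dpoly.
Qed.

Lemma deriv1_eq0 : D 1 = 0.
Proof. by have := D_leibniz 1 1; rewrite !mulr1 mul1r -[LHS]addr0 => /addrI. Qed.

Lemma DpolyC a : Dpoly a%:P = (D a)%:P.
Proof.
by apply/polyP => i; rewrite coef_Dpoly !coefC; case: eqP => // _; rewrite raddf0.
Qed.

Lemma DpolyXn n : Dpoly 'X^n = 0.
Proof.
apply/polyP => i; rewrite coef_Dpoly coefXn coef0.
by case: eqP => _; rewrite ?deriv1_eq0 ?raddf0.
Qed.

Lemma DpolyXnM n p : Dpoly ('X^n * p) = 'X^n * Dpoly p.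
Proof. by rewrite DpolyM DpolyXn mul0r add0r. Qed.

Lemma DpolyXM p : Dpoly ('X * p) = 'X * Dpoly p.
Proof. by rewrite -(expr1 'X) DpolyXnM. Qed.

Lemma Dpoly_exp p j : Dpoly (p ^+ j.+1) = (p ^+ j * Dpoly p) *+ j.+1.
Proof.
elim: j => [|j IH]; first by rewrite expr1 expr0 mul1r.
by rewrite exprS DpolyM IH [in RHS]mulrS exprS; ring.
Qed.

(** This is the rule [D (1 / (1 - h)) = D h / (1 - h) ^ 2]. The precision is not
    reduced because [D] kills the variable: the derivative of [h ^ n] is still a
    multiple of ['X^n]. *)
Lemma Dpoly_geom n p :
  eqX n (Dpoly (geom n ('X * p))) (geom n ('X * p) ^+ 2 * Dpoly ('X * p)).
Proof.
have [s es] := geom_invX n p.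
have : Dpoly (geom n ('X * p) * (1 - 'X * p)) = Dpoly ('X^0 - 'X^n * p ^+ n).
  by rewrite geom_inv exprMn.
set q := geom n ('X * p) in es *; set h := 'X * p in es *.
rewrite DpolyM !DpolyB DpolyXnM -(expr0 'X) !DpolyXn !sub0r => e.
exists (- s * Dpoly q - q * Dpoly (p ^+ n)).
have {1}-> : Dpoly q = q * (1 - h) * Dpoly q - 'X^n * s * Dpoly q.
  by rewrite es; ring.
rewrite expr0 in e.
have -> : q * (1 - h) * Dpoly q = q * (q * Dpoly h + (Dpoly q * (1 - h) + q * - Dpoly h)) by ring.
by rewrite e; ring.
Qed.
End Derivation.

(** * The continued fraction and its powers *)

Section ContinuedFraction.
Variables (S : comNzRingType) (u : nat -> S).

(** The fraction [q_k], cut after the variables [u_k, ..., u_(k+d-1)]; the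
    precision [n] is the length of the geometric sums that replace inverses. *)
Fixpoint cfrac (n d k : nat) : {poly S} :=
  if d is d'.+1 then geom n ('X * ((u k)%:P * cfrac n d' k.+1)) else 1.

(** A new level of the fraction enters with one more factor ['X] than the level
    above it. *)
Lemma cfrac_stable n d k : (0 < n)%N -> eqX d.+1 (cfrac n d k) (cfrac n d.+1 k).
Proof.
move=> n0; elim: d k => [|d IH] k; last exact/eqX_geom/eqXS/eqXMl/IH.
rewrite -[cfrac n 1 k]/(geom n ('X * ((u k)%:P * 1))).
case: n n0 => // n _; apply: eqX_sym.
exists ((u k)%:P * geom n ('X * ((u k)%:P * 1))).
rewrite /geom big_ord_recl expr0 /=; congr (_ + _).
by rewrite !mulr_sumr; apply: eq_bigr => i _; rewrite /bump expr1 [in LHS]exprS; ring.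
Qed.

(** The [a]-th power of the fraction, with each level expanded by the negative
    binomial series: the exponent of one level is the upper parameter of the
    binomial coefficients of the next. *)
Fixpoint cfrac_pow (n d k a : nat) : {poly S} :=
  if d is d'.+1 then
    \sum_(j < n) ('X * (u k)%:P) ^+ j * cfrac_pow n d' k.+1 j *+ 'C((a + j).-1, j)
  else 1.

Lemma cfrac_powE n d k a : eqX n (cfrac_pow n d k a) (cfrac n d k ^+ a).
Proof.
elim: d k a => [|d IH] k a /=; first by rewrite expr1n; apply: eqX_refl.
apply: eqX_trans (newton_geom n a _); apply: eqX_sum => j _.
rewrite mulrA [in X in eqX _ _ X]exprMn -!mulrnAr; apply: eqXMl.
by have [r ->] := IH k.+1 j; exists (r *+ 'C((a + j).-1, j)); rewrite mulrnDl mulrnAr.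
Qed.

End ContinuedFraction.

(** * The logarithm as a sum over multi-indices *)

Lemma big_tuple_cons (T : finType) (V : nmodType) n (G : n.+1.-tuple T -> V) :
  \sum_t G t = \sum_x \sum_(t : n.-tuple T) G (cons_tuple x t).
Proof.
rewrite pair_big /=; apply: (reindex (fun p => cons_tuple p.1 p.2)).
exists (fun t => (thead t, behead_tuple t)) => [[x t] _|t _] /=.
  by congr (_, _); apply: val_inj.
by rewrite [in RHS](tuple_eta t); apply: val_inj.
Qed.

Section Expansion.
Variables (F : fieldType) (S : comAlgType F) (u : nat -> S).

(** The coefficient of degree [n] of
    [log (1 / (1 - h)) = h + h ^ 2 / 2 + h ^ 3 / 3 + ...], where
    [h = t u_k q_(k+1)]; that is, of [log q_k]. *)
Definition cflog n d k : S :=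
  \sum_(j < n) j.+1%:R^-1 *: (('X * ((u k)%:P * cfrac u n.+1 d k.+1)) ^+ j.+1)`_n.

Definition monom k (s : seq nat) : S := \prod_(i < size s) u (k + i) ^+ nth 0%N s i.

Definition weight a (s : seq nat) : nat :=
  \prod_(i < size s) 'C((nth 0 (a :: s) i + nth 0 s i).-1, nth 0 s i).

Lemma monom_cons k b s : monom k (b :: s) = u k ^+ b * monom k.+1 s.
Proof.
rewrite /monom big_ord_recl /= addn0; congr (_ * _).
by apply: eq_bigr => i _; rewrite addnS.
Qed.

Lemma weight_cons a b s : weight a (b :: s) = ('C((a + b).-1, b) * weight b s)%N.
Proof. by rewrite /weight big_ord_recl. Qed.

Lemma cfrac_pow_expand n d k a :
  cfrac_pow u n d k a =
  \sum_(t : d.-tuple 'I_n) (let s := map val t in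
     ('X^(sumn s) * (monom k s)%:P) *+ weight a s).
Proof.
elim: d k a => [|d IH] k a /=.
  rewrite (big_pred1 [tuple]) => [|t]; last by rewrite [t]tuple0 [RHS]eqxx.
  by rewrite /monom /weight /= !big_ord0 mulr1.
rewrite big_tuple_cons; apply: eq_bigr => j _; rewrite IH mulr_sumr -sumrMnl.
apply: eq_bigr => t _ /=; rewrite monom_cons weight_cons mulnC mulrnA; congr (_ *+ _).
rewrite mulrnAr; congr (_ *+ _).
by rewrite exprMn exprD polyCM polyC_exp; ring.
Qed.

(** The first entry of the multi-index is the exponent of [h] in the logarithm,
    whence the factor [1 / alpha_1] and the condition [alpha_1 >= 1]; the other
    entries come from the expansion of [q_(k+1) ^ alpha_1]. *)
Lemma cflog_expand n d k :
  cflog n d k =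
  \sum_(t : d.+1.-tuple 'I_n.+1 | let s := map val t in
        (0 < head 0 s)%N && (sumn s == n))
     (let s := map val t in
      ((head 0 s)%:R^-1 * (weight (head 0 s) (behead s))%:R) *: monom k s).
Proof.
rewrite big_mkcond big_tuple_cons big_ord_recl [X in X + _]big1 ?add0r //.
apply: eq_bigr => j _.
have -> : ('X * ((u k)%:P * cfrac u n.+1 d k.+1)) ^+ j.+1 =
    'X^(j.+1) * (u k ^+ j.+1)%:P * cfrac u n.+1 d k.+1 ^+ j.+1.
  by rewrite mulrA !exprMn polyC_exp.
rewrite (eqX_coef (ltnSn n) (eqXMl _ (eqX_sym (cfrac_powE u n.+1 d k.+1 j.+1)))).
rewrite cfrac_pow_expand mulr_sumr coef_sum scaler_sumr; apply: eq_bigr => t _ /=.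
rewrite monom_cons [in LHS]mulrnAr coefMn mulrACA -exprD -polyCM coefMC coefXn eq_sym.
rewrite /bump add1n; case: eqP => _; last by rewrite mul0r mul0rn scaler0.
by rewrite mul1r -scaler_nat scalerA.
Qed.

Lemma leibniz_monom_eq0 (D : {additive S -> S}) k s :
  (forall a b, D (a * b) = D a * b + a * D b) ->
  (forall i, (i < size s)%N -> D (u (k + i)) = 0) -> D (monom k s) = 0.
Proof.
move=> DM; elim: s k => [|b s IH] k Du.
  by rewrite /monom big_ord0 deriv1_eq0.
rewrite monom_cons DM IH ?mulr0 ?addr0 => [|i si]; last by rewrite addSnnS Du.
suff -> : D (u k ^+ b) = 0 by rewrite mul0r.
have Dk : D (u k) = 0 by rewrite -[k]addn0 Du.
elim: (b) => [|c IHc]; first by rewrite expr0 deriv1_eq0.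
by rewrite exprS DM IHc Dk mul0r mulr0 addr0.
Qed.

Lemma leibniz_cflog_eq0 (D : {linear S -> S}) n d k :
  (forall a b, D (a * b) = D a * b + a * D b) ->
  (forall i, (k <= i <= k + d)%N -> D (u i) = 0) -> D (cflog n d k) = 0.
Proof.
move=> DM Du; rewrite cflog_expand raddf_sum /= big1 // => t _.
rewrite linearZ /= leibniz_monom_eq0 ?scaler0 // => i.
by rewrite size_map size_tuple ltnS => id; apply: Du; rewrite leq_addr leq_add2l.
Qed.

Lemma cflog_shift (f : {lrmorphism S -> S}) n d k :
  (forall i, f (u i) = u i.+1) -> f (cflog n d k) = cflog n d k.+1.
Proof.
move=> fu; rewrite !cflog_expand raddf_sum /=; apply: eq_bigr => t _.
rewrite linearZ /=; congr (_ *: _); rewrite rmorph_prod; apply: eq_bigr => i _.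
by rewrite rmorphXn /= fu.
Qed.

End Expansion.

(** * The derivation of the logarithms cancels *)

Section Cancellation.
Variables (F : numFieldType) (S : comAlgType F) (D : {linear S -> S}).
Hypothesis D_leibniz : forall a b, D (a * b) = D a * b + a * D b.
Variables (z w : nat -> S) (K : nat).
Hypothesis zw : forall k, z k * w k = 1.
Let u k := w k * w k.+1.
Hypothesis Du : forall k, (0 < k <= K)%N -> D (u k) = if odd k then w k.+1 else - w k.

Let Dp := Dpoly D.
Let q n d k := cfrac u n d k.
Let h n d k : {poly S} := 'X * ((u k)%:P * q n d k.+1).

Let zwP k : (z k)%:P * (w k)%:P = 1 :> {poly S}.
Proof. by rewrite -polyCM zw. Qed.

(** The expected value of [D q_k]. *)
Definition Dcfrac n d k : {poly S} :=
  if odd k then (z k)%:P * (q n d k - 1) else - ('X * (w k)%:P * q n d k ^+ 2).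

(** The expected value of [D h_k], where [q_k = 1 / (1 - h_k)]. *)
Definition Dtail n d k : {poly S} :=
  if odd k then 'X * (w k.+1)%:P * q n d k.+1 * (1 - h n d k) else - ('X * (w k)%:P).

(** The Leibniz rule for [u_k q_(k+1)]. The factor ['X] in [h] raises the
    precision by one. *)
Lemma Dtail_step m n d k : (0 < k <= K)%N ->
  eqX m (Dp (q n d k.+1)) (Dcfrac n d k.+1) -> eqX m.+1 (Dp (h n d k)) (Dtail n d k).
Proof.
move=> kK e; rewrite /h /Dp DpolyXM //.
suff -> : Dtail n d k = 'X * ((D (u k))%:P * q n d k.+1 + (u k)%:P * Dcfrac n d k.+1).
  apply: eqXS; rewrite DpolyM // DpolyC; apply: eqXD; first exact: eqX_refl.
  exact: eqXMl.
rewrite /Dtail /Dcfrac /h Du //= -/(q n d k.+1) /u polyCM.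
have := zwP k.+1; set zz := (z _)%:P; set ww := (w k.+1)%:P => zww.
move: (q n d k.+1) => Q; case: (odd k) => /=; first by ring.
rewrite polyCN; have -> : (w k)%:P * ww * (zz * (Q - 1)) = zz * ww * ((w k)%:P * (Q - 1)) by ring.
by rewrite zww; ring.
Qed.

(** [D q_k = q_k ^ 2 D h_k] is the expected value at once for even [k]; for odd
    [k] the factor [1 - h_k] of [D h_k] absorbs one [q_k], and
    [z_k h_k q_k = z_k (q_k - 1)]. *)
Lemma Dcfrac_step m n d k : (m <= n)%N ->
  eqX m (Dp (h n d k)) (Dtail n d k) -> eqX m (Dp (q n d.+1 k)) (Dcfrac n d.+1 k).
Proof.
move=> mn e; have [s es] := geom_invX n ((u k)%:P * q n d k.+1).
rewrite -/(h n d k) -[geom n _]/(q n d.+1 k) in es.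
apply: eqX_trans (eqX_leq mn (Dpoly_geom D_leibniz n _)) _.
rewrite -/(h n d k) -[geom n _]/(q n d.+1 k) -/Dp.
apply: eqX_trans (eqXMl _ e) _; apply: eqX_leq mn _.
rewrite /Dtail /Dcfrac; case: (odd k); last first.
  by set Q := q _ _ _; exists 0; ring.
set Q := q n d.+1 k in es *; set Q' := q n d k.+1.
have Qe : Q - 1 = Q * h n d k + 'X^n * s.
  have -> : Q - 1 = Q * h n d k + (Q * (1 - h n d k) - 1) by ring.
  by rewrite es; ring.
have zu : (z k)%:P * h n d k = 'X * (w k.+1)%:P * Q'.
  rewrite /h /u polyCM.
  have -> : (z k)%:P * ('X * ((w k)%:P * (w k.+1)%:P * q n d k.+1)) =
            (z k)%:P * (w k)%:P * ('X * (w k.+1)%:P * Q') by rewrite /Q'; ring.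
  by rewrite zwP mul1r.
exists (s * (Q * 'X * (w k.+1)%:P * Q') - (z k)%:P * s); rewrite Qe.
have -> : Q ^+ 2 * ('X * (w k.+1)%:P * Q' * (1 - h n d k)) =
  Q * (1 - h n d k) * (Q * ('X * (w k.+1)%:P * Q')) by ring.
have -> : (z k)%:P * (Q * h n d k + 'X^n * s) =
  Q * ((z k)%:P * h n d k) + (z k)%:P * ('X^n * s) by ring.
by rewrite es zu; ring.
Qed.

(** At depth [0] the fraction is the constant [1]: the rule is then an equality
    for odd [k], and a congruence modulo ['X] for even [k]. *)
Lemma Dcfrac_eq m n d k : (m <= n)%N -> (m <= d.+1)%N -> (0 < k)%N -> (k + d <= K.+1)%N ->
  eqX m (Dp (q n d k)) (Dcfrac n d k).
Proof.
elim: d k m => [|d IH] k m mn md k0 kd.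
  rewrite /Dp /q /= -(expr0 'X) DpolyXn // /Dcfrac /q /=.
  apply: eqX_leq md _; case: (odd k); first by exists 0; ring.
  by exists (w k)%:P; ring.
case: m mn md => [|m] mn md; first exact: eqX0.
apply: Dcfrac_step => //; apply: Dtail_step; first by rewrite k0 /=; lia.
by apply: IH; lia.
Qed.

(** [D (log q) = q D h]: the coefficients [1 / j] cancel the exponents. *)
Lemma D_cflog n d k : D (cflog u n d k) = (q n.+1 d.+1 k * Dp (h n.+1 d k))`_n.
Proof.
rewrite raddf_sum -[q n.+1 d.+1 k]/(geom n.+1 (h n.+1 d k)).
rewrite /geom mulr_suml coef_sum big_ord_recr /=.
rewrite [X in _ = _ + X](_ : _ = 0) ?addr0.
  apply: eq_bigr => j _; rewrite linearZ /= -(coef_Dpoly D) Dpoly_exp // -/Dp coefMn.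
  by rewrite -scaler_nat scalerA mulVf ?scale1r // pnatr_eq0.
rewrite /h /Dp DpolyXM //.
rewrite exprMn mulrACA -exprSr coefXnM ltnS leqnn //.
Qed.

(** For odd [k] the two derivatives are [+ t q_(k+1) / z_(k+1)] and
    [- t q_(k+1) / z_(k+1)], but with the fraction [q_(k+1)] cut at the depths
    [d] and [d + 1]; [cfrac_stable] bounds the difference. *)
Lemma D_cflog_pair n d k : odd k -> (n <= d.+1)%N -> (k + d < K)%N ->
  D (cflog u n d k + cflog u n d k.+1) = 0.
Proof.
move=> ok nd kd; have k0 : (0 < k)%N by case: k ok kd.
have tail i : (0 < i)%N -> (i + d <= K)%N ->
    eqX n.+1 (Dp (h n.+1 d i)) (Dtail n.+1 d i).
  by move=> i0 iK; apply: Dtail_step; [rewrite i0; lia | apply: Dcfrac_eq; lia].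
rewrite raddfD /= !D_cflog -coefD.
have e1 := eqXMl (q n.+1 d.+1 k) (tail k k0 (ltnW kd)).
have e2 := eqXMl (q n.+1 d.+1 k.+1) (tail k.+1 isT kd).
rewrite (eqX_coef (ltnSn n) (eqXD e1 e2)) /Dtail oddS ok.
have [s es] := geom_invX n.+1 ((u k)%:P * q n.+1 d k.+1).
rewrite -/(h n.+1 d k) -[geom n.+1 _]/(q n.+1 d.+1 k) in es.
have [r er] := cfrac_stable u d k.+1 (ltn0Sn n); rewrite -!/(q _ _ _) in er.
set W := (w k.+1)%:P; set Q := q n.+1 d.+1 k in es *; set P := q n.+1 d.+1 k.+1 in er *.
have -> : Q * ('X * W * q n.+1 d k.+1 * (1 - h n.+1 d k)) + P * - ('X * W) =
    'X^(n.+1) * (s * ('X * W * q n.+1 d k.+1)) + 'X^(d.+2) * (W * r).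
  have -> : Q * ('X * W * q n.+1 d k.+1 * (1 - h n.+1 d k)) =
    Q * (1 - h n.+1 d k) * ('X * W * q n.+1 d k.+1) by ring.
  by rewrite es er [in RHS](exprS 'X d.+1); ring.
by rewrite coefD !coefXnM ltnSn ltnS nd addr0.
Qed.
End Cancellation.

(** * Sums over all integers with finite support *)

Section FiniteSupport.
Variables (I : choiceType) (V : nmodType).
Implicit Types f g : I -> V.

Lemma fsum_supp f (A : {fset I}) (h : finite_set [set i | f i != 0]) :
  (fset_set [set i | f i != 0] `<=` A)%fset ->
  \sum_(i \in [set: I]) f i = \sum_(i <- A) f i.
Proof.
move=> sub; apply: fsbigTE => i iA; apply/eqP; apply: contraNT iA => fi.
by apply: (fsubsetP sub); rewrite in_fset_set // inE.
Qed.

Lemma fsumD f g :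
  finite_set [set i | f i != 0] -> finite_set [set i | g i != 0] ->
  \sum_(i \in [set: I]) (f i + g i) =
  \sum_(i \in [set: I]) f i + \sum_(i \in [set: I]) g i.
Proof.
move=> hf hg; pose A := (fset_set [set i | f i != 0] `|` fset_set [set i | g i != 0])%fset.
rewrite (fsum_supp hf (fsubsetUl _ _ : _ `<=` A)%fset).
rewrite (fsum_supp hg (fsubsetUr _ _ : _ `<=` A)%fset) -big_split.
apply: fsbigTE => i; rewrite in_fsetU !in_fset_set // negb_or => /andP[].
by rewrite !notin_setE /= => /negP/negPn/eqP -> /negP/negPn/eqP ->; rewrite addr0.
Qed.

Lemma raddf_fsum (W : nmodType) (phi : {additive V -> W}) f :
  finite_set [set i | f i != 0] ->
  phi (\sum_(i \in [set: I]) f i) = \sum_(i \in [set: I]) phi (f i).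
Proof.
move=> hf; rewrite (fsum_supp hf (fsubset_refl _)) raddf_sum; symmetry.
apply: fsbigTE => i; rewrite in_fset_set // notin_setE /= => /negP/negPn/eqP ->.
exact: raddf0.
Qed.
End FiniteSupport.

(** * The Poisson brackets with Sigma+ and Sigma- *)

Section Brackets.
Variable F : fieldType.
Local Notation L := (laurent F).
Implicit Types P Q : L.

Lemma pbracket_is_linear P : linear (pbracket P : L -> L).
Proof. by move=> c Q Q'; rewrite pbracketDr pbracketZr. Qed.
HB.instance Definition _ P :=
  GRing.isLinear.Build F L L *:%R (pbracket P) (pbracket_is_linear P).

Lemma Sp_bracketD P Q : homog 0 P -> homog 0 Q ->
  Sp_bracket (P + Q) = Sp_bracket P + Sp_bracket Q.
Proof.
move=> hP hQ; rewrite /Sp_bracket -(fsumD (finite_br_lx hP) (finite_br_lx hQ)).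
by apply: eq_fsbigr => i _; rewrite pbracketDr.
Qed.

Lemma Sm_bracketD P Q : homog 0 P -> homog 0 Q ->
  Sm_bracket (P + Q) = Sm_bracket P + Sm_bracket Q.
Proof.
move=> hP hQ; rewrite /Sm_bracket -(fsumD (finite_br_ly hP) (finite_br_ly hQ)).
by apply: eq_fsbigr => i _; rewrite pbracketDr.
Qed.

Lemma omega_half u v : omega (half_shift u) (half_shift v) = omega u v.
Proof.
case: u v => [i|i] [j|j] //=; last by rewrite opprD addrACA subrr addr0.
  by rewrite lezD1 ltNge; case: (i <= j).
by rewrite lezD1 ltNge; case: (j <= i).
Qed.

Local Notation push a := (malg_push (G := int) half_shift a : expo).

Lemma push_halfN (a : expo) : push (- a) = - push a.
Proof. exact: (raddfN (malg_push (G := int) half_shift : {additive expo -> expo})). Qed.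

Lemma push_halfD (a b : expo) : push (a + b) = push a + push b.
Proof. exact: (raddfD (malg_push (G := int) half_shift : {additive expo -> expo})). Qed.

Lemma eomega_half (a b : expo) : eomega (push a) (push b) = eomega a b.
Proof.
have eomegaN (c d : expo) : eomega (- c) d = - eomega c d by rewrite /eomega raddfN.
have eomegaNr (c d : expo) : eomega c (- d) = - eomega c d.
  by rewrite [LHS]eomegaC eomegaN -eomegaC.
have eomega0 (d : expo) : eomega 0 d = 0 by rewrite /eomega raddf0.
move: a; apply: expo_ind => [|u|a IH|a a' IH IH'].
- by rewrite raddf0 !eomega0.
- rewrite push_gexp.
  move: b; apply: expo_ind => [|v|b IH|b b' IH IH'].
  + by rewrite raddf0 ![eomega _ 0]eomegaC !eomega0.
  + by rewrite push_gexp !eomega_gexp2 omega_half.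
  + by rewrite push_halfN !eomegaNr IH.
  + by rewrite push_halfD !eomegaDr IH IH'.
- by rewrite push_halfN !eomegaN IH.
- by rewrite push_halfD !eomegaDl IH IH'.
Qed.

(** The half shift is a Poisson automorphism: in the order
    [... < x_i < y_i < x_(i+1) < ...] the form [omega u v] depends only on which
    of the two generators comes first and on the parity of their distance. *)
Lemma Thalf_pbracket P Q : Thalf (pbracket P Q) = pbracket (Thalf P) (Thalf Q).
Proof.
elim/gr_ind: P => [|a|c P IH|P P' IH IH'].
- by rewrite pbracket0l raddf0 pbracket0l.
- elim/gr_ind: Q => [|b|c Q IH|Q Q' IH IH'].
  + by rewrite pbracket0r raddf0 pbracket0r.
  + rewrite pbracket_zpow linearZ /= /Thalf !rename_zpow pbracket_zpow eomega_half.
    by rewrite push_halfD.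
  + by rewrite pbracketZr !linearZ /= IH.
  + by rewrite pbracketDr !raddfD /= IH IH'.
- by rewrite pbracketZl !linearZ /= IH pbracketZl.
- by rewrite pbracketDl !raddfD /= IH IH' pbracketDl.
Qed.

Lemma Sm_bracket_half P : homog 0 P -> Sm_bracket (Thalf P) = Thalf (Sp_bracket P).
Proof.
move=> hP; rewrite /Sp_bracket raddf_fsum; last exact: finite_br_lx.
by apply: eq_fsbigr => i _; rewrite /= Thalf_pbracket Thalf_lx.
Qed.

Lemma Sp_bracket_half P : homog 0 P -> Sp_bracket (Thalf P) = Thalf (Sm_bracket P).
Proof.
move=> hP; rewrite /Sm_bracket raddf_fsum; last exact: finite_br_ly.
rewrite /Sp_bracket (reindex_fsbigT (fun i : int => i + 1)) /=; last first.
  by exists (fun i => i - 1) => i; rewrite ?addrK ?subrK.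
by apply: eq_fsbigr => i _; rewrite /= Thalf_pbracket Thalf_ly.
Qed.

Lemma Thalf_half P : Thalf (Thalf P) = T P.
Proof.
rewrite -[LHS]/((rename half_shift \o rename half_shift) P) rename_comp.
apply: (@rename_unique _ (rename (half_shift \o half_shift) : {lrmorphism L -> L})) => u.
by rewrite /= rename_gexp; case: u.
Qed.

(** The generators in the order [y_0, x_1, y_1, x_2, ...]; index [1] is [x_1]. *)
Definition zgen (k : nat) : gen := if odd k then inl (k./2.+1)%:Z else inr (k./2)%:Z.
Definition zvar k : L := zpow F (gexp (zgen k)).
Definition zinv k : L := (zvar k)^-1.
Definition uvar k : L := zinv k * zinv k.+1.

Lemma zvarV k : zvar k * zinv k = 1.
Proof. by rewrite mulrV // zpow_unit. Qed.

Lemma uvarE k : uvar k = (zvar k * zvar k.+1)^-1.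
Proof. by rewrite invrM ?zpow_unit // mulrC. Qed.

Lemma zvar_odd m : zvar (2 * m).+1 = lx F m.+1%:Z.
Proof. by rewrite /zvar /zgen /= mul2n odd_double /= uphalf_double. Qed.

Lemma zvar_even m : zvar (2 * m) = ly F m%:Z.
Proof. by rewrite /zvar /zgen mul2n odd_double doubleK. Qed.

Lemma zgen_half k : half_shift (zgen k) = zgen k.+1.
Proof.
rewrite /zgen /= uphalf_half; case: (odd k) => //=.
by rewrite add0n intS addrC.
Qed.

Lemma Thalf_uvar k : Thalf (uvar k) = uvar k.+1.
Proof.
rewrite /uvar /zinv /zvar -!zpowN -!zpowD /Thalf rename_zpow.
by rewrite push_halfD !push_halfN !push_gexp !zgen_half.
Qed.

Lemma omega_zgen i k : omega (inl i) (zgen k) + omega (inl i) (zgen k.+1) =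
  if i == (k./2.+1)%:Z then (if odd k then - 1 else 1) else 0.
Proof.
rewrite /zgen /= uphalf_half; case: (odd k) => /=; rewrite ?add0n ?add1n.
  by case: (ltgtP i (k./2.+1)%:Z) => [h|h|->]; rewrite ?subrr ?sgr0 //;
    [rewrite gtr0_sg ?subr_gt0 | rewrite ltr0_sg ?subr_lt0].
case: (ltgtP i (k./2.+1)%:Z) => [h|h|->]; last by rewrite subrr sgr0 lez_nat ltnn addr0.
  by rewrite gtr0_sg ?subr_gt0 // ifT //; lia.
by rewrite ltr0_sg ?subr_lt0 // ifF //; lia.
Qed.

(** The brackets of [x_i] with [z_k] and [z_(k+1)] have opposite coefficients
    unless [x_i] is one of them. *)
Lemma pbracket_lx_uvar i k : pbracket (lx F i) (uvar k) =
  if i == (k./2.+1)%:Z then (if odd k then zinv k.+1 else - zinv k) else 0.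
Proof.
have uE : uvar k = zpow F (- gexp (zgen k) - gexp (zgen k.+1)).
  by rewrite /uvar /zinv -!zpowN zpowD.
rewrite {1}uE pbracket_zpow eomega_gexp raddfB raddfN /= !expo_ext_gexp -opprD omega_zgen.
rewrite zpowD -uE -/(lx F i); case: eqP => [->|_]; last by rewrite oppr0 scale0r.
have odd_lx j : odd j -> lx F (j./2.+1)%:Z = zvar j by rewrite /zvar /zgen => ->.
case: (boolP (odd k)) => ok; rewrite ?opprK ?rmorphN /= ?scaleNr !scale1r.
  by rewrite odd_lx // mulrA zvarV mul1r.
have <- : (k.+1)./2 = k./2 by rewrite /= uphalf_half (negPf ok).
by rewrite odd_lx // /uvar mulrCA zvarV mulr1.
Qed.

(** The bracket with [x_1 + ... + x_N]. Unlike the bracket with the infinite sum,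
    which is meaningful in degree [0] only, it is a derivation of the whole
    ring. *)
Definition Sp_upto (N : nat) P : L := \sum_(i < N) pbracket (lx F i.+1%:Z) P.

Lemma Sp_upto_is_linear N : linear (Sp_upto N).
Proof.
move=> c P Q; rewrite /Sp_upto scaler_sumr -big_split; apply: eq_bigr => i _.
exact: linearP.
Qed.
HB.instance Definition _ N :=
  GRing.isLinear.Build F L L *:%R (Sp_upto N) (Sp_upto_is_linear N).

Lemma Sp_upto_leibniz N P Q : Sp_upto N (P * Q) = Sp_upto N P * Q + P * Sp_upto N Q.
Proof.
rewrite /Sp_upto mulr_suml mulr_sumr -big_split; apply: eq_bigr => i _.
exact: pbracket_leibniz.
Qed.

Lemma Sp_upto_uvar N k : (k < 2 * N)%N ->
  Sp_upto N (uvar k) = if odd k then zinv k.+1 else - zinv k.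
Proof.
move=> kN; have kN2 : (k./2 < N)%N by lia.
rewrite /Sp_upto (bigD1 (Ordinal kN2)) //= pbracket_lx_uvar eqxx big1 ?addr0 // => i ik.
rewrite pbracket_lx_uvar; case: eqP => // -[] e.
by case/eqP: ik; apply: val_inj.
Qed.

Lemma Sp_bracket_upto N P :
  (forall i : int, (forall j : nat, (j < N)%N -> i != j.+1%:Z) -> pbracket (lx F i) P = 0) ->
  Sp_bracket P = Sp_upto N P.
Proof.
move=> h; pose r := [seq (j.+1%:Z : int) | j <- iota 0 N].
have ur : uniq r by rewrite map_inj_uniq ?iota_uniq // => i j [].
rewrite /Sp_bracket (fsbigE r) //=.
  rewrite big_map (eq_bigl xpredT) => [|i]; last by rewrite in_setT.
  by rewrite -[N]subn0 big_mkord subn0.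
move=> i _ ir; apply: h => j jN; apply: contraNneq ir => ->.
by apply: map_f; rewrite mem_iota.
Qed.

End Brackets.

(** * The densities as coefficients of logarithms *)

Section Density.
Variable F : fieldType.
Local Notation u := (uvar F).

Lemma binomZ_nat a b : binomZ (a%:Z + b%:Z - 1) b%:Z = 'C((a + b).-1, b).
Proof.
rewrite /binomZ; case: b => [|b]; first by rewrite bin0.
rewrite addnS /= (_ : a%:Z + b.+1%:Z - 1 = (a + b)%N%:Z); last by lia.
case: ifP => [h|_ //]; rewrite bin_small //; lia.
Qed.

Lemma big_pair_nat (V : comPzSemiRingType) (g : nat -> V) N :
  \prod_(1 <= k < N.+1) (g (2 * k - 1)%N * g (2 * k)%N) = \prod_(i < 2 * N) g i.+1.
Proof.
elim: N => [|N IH]; first by rewrite big_geq // big_ord0.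
by rewrite big_nat_recr //= IH mulnS !big_ord_recr /= mulrA; congr (_ * g _ * g _); lia.
Qed.

Lemma A'cl_cflog n N : (1 < N)%N -> A'cl F n N = cflog u n (2 * N - 3) 1.
Proof.
move=> N1; rewrite cflog_expand.
pose G (s : seq nat) : laurent F :=
  ((head 0%N s)%:R^-1 * (weight (head 0%N s) (behead s))%:R) *: monom u 1 s.
have -> : A'cl F n N = \sum_(t : (2 * N - 2).-tuple 'I_n.+1 |
  let s := map val t in (0 < head 0 s)%N && (sumn s == n)) G (map val t).
  apply: eq_big => [t|t _].
    rewrite inE /entry nth0; congr (_ && (_ == n)).
    rewrite big_add1 big_mkord sumnE (big_nth 0%N) big_mkord size_map size_tuple.
    by [].
  rewrite /G /entry nth0; set s := map val t.
  have ss : size s = (2 * N - 2)%N by rewrite size_map size_tuple.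
  congr (_ * _ *: _).
    rewrite /weight natr_prod big_add1 big_mkord size_behead ss.
    rewrite (_ : (2 * N - 2).-1 = (2 * N - 3)%N); last by lia.
    apply: eq_bigr => i _; rewrite binomZ_nat; case: (s) ss => //=; first lia.
  rewrite /monom ss (_ : (2 * N - 2)%N = (2 * N.-1)%N); last by lia.
  rewrite -(big_pair_nat (fun i => u i ^+ nth 0%N s i.-1)) prednK; last by lia.
  rewrite [in RHS]big_nat [in LHS]big_nat; apply: eq_bigr => -[//|k] _.
  rewrite (_ : 2 * k.+1 - 1 = (2 * k).+1)%N; last by lia.
  rewrite !uvarE (_ : (2 * k).+2 = 2 * k.+1)%N; last by lia.
  by rewrite !zvar_odd !zvar_even !exprVn [in LHS](addrC _ 1) -intS.
have e : (2 * N - 2)%N = (2 * N - 3).+1 by lia.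
by rewrite e.
Qed.
End Density.

(** * The density of integral of motion *)

Theorem mainTheorem3 (R : realType) (n N : nat)
    (hn : (1 <= n)%N) (hN : (n <= 2 * (N - 1))%N) :
  motion_density (psi'cl R[i] n N) /\
  Sp_bracket (psi'cl R[i] n N) = 0 /\
  Sm_bracket (psi'cl R[i] n N) =
    T (bracket_Sm (A'cl R[i] n N)) - bracket_Sm (A'cl R[i] n N).
Proof.
have N1 : (1 < N)%N by lia.
set A := A'cl R[i] n N; have hA : homog 0 A by apply: homog_A'cl.
have hB : homog 0 (Thalf A) by rewrite -oppr0; apply: homog_Thalf.
have AE : A = cflog (uvar _) n (2 * N - 3) 1 by apply: A'cl_cflog.
have BE : Thalf A = cflog (uvar _) n (2 * N - 3) 2.
  by rewrite AE cflog_shift //; apply: Thalf_uvar.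
(* All the variables involved are [u_1, ..., u_(2N-1)], on which only
   [x_1, ..., x_N] act. *)
have Sp0 : Sp_bracket (psi'cl R[i] n N) = 0.
  rewrite (@Sp_bracket_upto _ N) => [|i iN].
    rewrite /psi'cl /B'cl -/A BE AE.
    apply: (@D_cflog_pair _ _ _ _ (zvar R[i]) (zinv R[i]) (2 * N - 1)) => //; try lia.
    - exact: Sp_upto_leibniz.
    - exact: zvarV.
    - by move=> k kN; apply: Sp_upto_uvar; lia.
  rewrite /psi'cl /B'cl -/A BE AE pbracketDr.
  have kill k : (k < 2 * N)%N -> pbracket (lx R[i] i) (uvar R[i] k) = 0.
    by move=> kN; rewrite pbracket_lx_uvar (negPf (iN _ _)) //; lia.
  rewrite !leibniz_cflog_eq0 ?addr0 //; try exact: pbracket_leibniz.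
    by move=> k kN; apply: kill; lia.
  by move=> k kN; apply: kill; lia.
have SmE : Sm_bracket (psi'cl R[i] n N) = T (bracket_Sm A) - bracket_Sm A.
  have SpA : Sp_bracket A = - Thalf (Sm_bracket A).
    apply/eqP; rewrite -addr_eq0 -Sp_bracket_half // -Sp_bracketD //.
    exact/eqP.
  rewrite /psi'cl Sm_bracketD // Sm_bracket_half // -/A SpA.
  by rewrite raddfN /= Thalf_half /bracket_Sm raddfN opprK addrC.
split; last by [].
split; last by exists (bracket_Sm A).
by exists 0; rewrite Sp0 raddf0 subr0.
Qed.
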